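(* Let $\mathcal{F}$ be a family of finite graded vertically indecomposable lattices (considered up to isomorphism) that is closed under vertical 2-sum. Let $f_{\mathrm{vi}}(n)$ and $f_{\mathrm{pc}}(n)$ be the numbers of $n$-element lattices in $\mathcal{F}$ and of $n$-element pieces in $\mathcal{F}$, respectively. Let $N \ge 6$ be an integer constant, and let $\underline{f} \colon \mathbb{N}^+ \to \mathbb{N}^+$ be defined by $\underline{f}(n) = f_{\mathrm{pc}}(n)$ for $1 \le n \le 6$, \[ \underline{f}(n) = f_{\mathrm{pc}}(n) + \sum_{k=6}^{n-1} f_{\mathrm{pc}}(k)\, \underline{f}(n-k+4) \quad \text{for } 7 \le n \le N, \] and \[ \underline{f}(n) = \sum_{k=6}^{N} f_{\mathrm{pc}}(k)\, \underline{f}(n-k+4) \quad \text{for } n \ge N+1. \] Then $f_{\mathrm{vi}}(n) \ge \underline{f}(n)$ for all $n \ge 1$.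
   Context: A knot of a lattice $X$ is an element distinct from top and bottom that is comparable to all elements; a lattice is vertically indecomposable if it has no knot. For a lattice $L$ with exactly two coatoms and a lattice $U$ with exactly two atoms, a vertical 2-sum $L +_2 U$ is the poset obtained by removing the top of $L$ and the bottom of $U$ and identifying the two coatoms of $L$ with the two atoms of $U$ via some bijection (with order generated by the orders of the two parts); it is a lattice with $|L|+|U|-4$ elements. ''Closed under vertical 2-sum'' means every vertical 2-sum of members of $\mathcal{F}$ (where defined) lies in $\mathcal{F}$. In a graded lattice $X$, two elements form a neck if (1) they have the same rank, (2) they are the only elements of $X$ of that rank, and (3) they are neither atoms nor coatoms. A piece is a graded vertically indecomposable lattice that has exactly two atoms, exactly two coatoms, no neck, and rank at least three. *)

(* Defs.v *)
From mathcomp Require Import all_boot.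
From mathcomp Require Import fingroup perm.
Set Implicit Arguments. Unset Strict Implicit. Unset Printing Implicit Defensive.

(* A finite poset/lattice with n elements is encoded on the carrier 'I_n by
   its order relation le, stored as a finite boolean function:
   R (x, y) = true  <->  x <= y. *)
Definition rel_on (n : nat) := {ffun 'I_n * 'I_n -> bool}.

Section Lat.
Variables (n : nat) (R : rel_on n).

Definition le (x y : 'I_n) : bool := R (x, y).
Definition lt (x y : 'I_n) : bool := le x y && (x != y).

Definition is_poset : bool :=
  [&& [forall x, le x x],
      [forall x, forall y, (le x y && le y x) ==> (x == y)] &
      [forall x, forall y, forall z, (le x y && le y z) ==> le x z]].

Definition is_lub (x y z : 'I_n) : bool :=
  [&& le x z, le y z & [forall w, (le x w && le y w) ==> le z w]].
Definition is_glb (x y z : 'I_n) : bool :=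
  [&& le z x, le z y & [forall w, (le w x && le w y) ==> le w z]].

Definition is_lattice : bool :=
  [&& 0 < n, is_poset,
      [forall x, forall y, exists z, is_lub x y z] &
      [forall x, forall y, exists z, is_glb x y z]].

Definition is_top (t : 'I_n) : bool := [forall y, le y t].
Definition is_bot (b : 'I_n) : bool := [forall y, le b y].

Definition covers (x y : 'I_n) : bool :=
  lt x y && [forall z, ~~ (lt x z && lt z y)].

Definition is_atom (a : 'I_n) : bool := [exists b, is_bot b && covers b a].
Definition is_coatom (a : 'I_n) : bool := [exists t, is_top t && covers a t].

Definition atoms : {set 'I_n} := [set a | is_atom a].
Definition coatoms : {set 'I_n} := [set a | is_coatom a].

Definition is_knot (x : 'I_n) : bool :=
  [&& ~~ is_top x, ~~ is_bot x & [forall y, le x y || le y x]].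

Definition vert_indec : bool := [forall x, ~~ is_knot x].

(* rank function: bottom has rank 0 and ranks increase by one along covers.
   (Any such function takes values < n, so the codomain 'I_n loses nothing.) *)
Definition is_rank_fn (r : {ffun 'I_n -> 'I_n}) : bool :=
  [forall b, is_bot b ==> (r b == 0 :> nat)] &&
  [forall x, forall y, covers x y ==> (r y == (r x).+1 :> nat)].

Definition graded : bool := [exists r, is_rank_fn r].

Definition is_neck (r : {ffun 'I_n -> 'I_n}) (x y : 'I_n) : bool :=
  [&& x != y, r x == r y,
      [forall z, (r z == r x) ==> ((z == x) || (z == y))],
      ~~ is_atom x, ~~ is_atom y, ~~ is_coatom x & ~~ is_coatom y].

Definition is_piece : bool :=
  [&& is_lattice, vert_indec, #|atoms| == 2, #|coatoms| == 2 &
      [exists r, [&& is_rank_fn r,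
                     ~~ [exists x, exists y, is_neck r x y] &
                     [forall t, is_top t ==> (3 <= r t)]]]].

End Lat.

Definition iso n (R R' : rel_on n) : bool :=
  [exists p : {perm 'I_n}, [forall x, forall y, R' (p x, p y) == R (x, y)]].

Definition num_classes n (S : {set rel_on n}) : nat :=
  #|[set [set R' in S | iso R R'] | R in S]|.

Definition lat_family := forall n : nat, {set rel_on n}.

Definition f_vi (F : lat_family) (n : nat) : nat := num_classes (F n).
Definition f_pc (F : lat_family) (n : nat) : nat :=
  num_classes [set R in F n | is_piece R].

Definition gen_rel m k n (L : rel_on m) (U : rel_on k)
  (phi : 'I_m -> 'I_n) (psi : 'I_k -> 'I_n) : rel 'I_n :=
  fun x y =>
    [exists a, exists a', [&& ~~ is_top L a, ~~ is_top L a',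
                              phi a == x, phi a' == y & le L a a']] ||
    [exists b, exists b', [&& ~~ is_bot U b, ~~ is_bot U b',
                              psi b == x, psi b' == y & le U b b']].

(* X is (a labelled copy of) a vertical 2-sum L +_2 U: remove the top of L
   and the bottom of U, identify the two coatoms of L with the two atoms of U
   via a bijection, and take the order generated by the two parts. *)
Definition vsum2 m k n (L : rel_on m) (U : rel_on k) (X : rel_on n) : Prop :=
  [/\ is_lattice L, is_lattice U, #|coatoms L| = 2, #|atoms U| = 2 &
  exists (phi : 'I_m -> 'I_n) (psi : 'I_k -> 'I_n),
    [/\ {in [pred a | ~~ is_top L a] &, injective phi},
        {in [pred b | ~~ is_bot U b] &, injective psi},
        (forall x, (exists2 a, ~~ is_top L a & phi a = x) \/
                   (exists2 b, ~~ is_bot U b & psi b = x)),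
        ((forall a b, ~~ is_top L a -> ~~ is_bot U b -> phi a = psi b ->
                     is_coatom L a /\ is_atom U b) /\
         (forall a, is_coatom L a -> exists2 b, is_atom U b & phi a = psi b)) &
        (forall x y, le X x y = connect (gen_rel L U phi psi) x y)]].

(* Main.v *)
(* Let h(n) count the n-element members of F with exactly two atoms and rank at
   least three.  Gluing a piece P under such a lattice U again gives one, and P
   and U can be recovered from the sum X: X is graded by the hypothesis on F, and
   the glued pair is a neck of X, in fact the lowest one because P has no neck, so
   P and U are, up to the removed extremes, the elements of X of rank at most,
   respectively at least, that of the neck.  Hence pieces and the various sums are
   pairwise non-isomorphic, h satisfies the recurrence of g with >= in place of =,
   and g <= h <= f_vi. *)

Require Import Defs.
From mathcomp Require Import all_boot.
From mathcomp Require Import fingroup perm zify.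
Set Implicit Arguments. Unset Strict Implicit. Unset Printing Implicit Defensive.

(** * Finite posets: covers, atoms, coatoms and rank functions *)

Section FinitePoset.
Variables (n : nat) (R : rel_on n).
Hypothesis posR : is_poset R.

Lemma le_refl x : le R x x.
Proof. by case/and3P: posR => /forallP/(_ x). Qed.

Lemma le_anti x y : le R x y -> le R y x -> x = y.
Proof.
case/and3P: posR => _ /forallP/(_ x)/forallP/(_ y)/implyP h _ xy yx.
by apply/eqP/h; rewrite xy.
Qed.

Lemma le_trans y x z : le R x y -> le R y z -> le R x z.
Proof.
case/and3P: posR => _ _ /forallP/(_ x)/forallP/(_ y)/forallP/(_ z)/implyP h xy yz.
by apply: h; rewrite xy.
Qed.

Lemma ltW x y : lt R x y -> le R x y. Proof. by case/andP. Qed.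

Lemma lt_nle x y : lt R x y -> le R y x = false.
Proof.
by case/andP=> xy; apply: contraNF => yx; apply/eqP/le_anti.
Qed.

Lemma top_unique s t : is_top R s -> is_top R t -> s = t.
Proof. by move=> /forallP/(_ t) ts /forallP/(_ s) st; apply: le_anti. Qed.

Lemma bot_unique s t : is_bot R s -> is_bot R t -> s = t.
Proof. by move=> /forallP/(_ t) ts /forallP/(_ s) st; apply: le_anti. Qed.

Lemma top_eq t x : is_top R t -> is_top R x = (x == t).
Proof.
by move=> tt; apply/idP/eqP => [/top_unique/(_ tt)|->].
Qed.

Lemma bot_eq t x : is_bot R t -> is_bot R x = (x == t).
Proof.
by move=> tt; apply/idP/eqP => [/bot_unique/(_ tt)|->].
Qed.

(** The size of the principal down-set is a strictly increasing measure; minimal choices and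
    inductions along the order all use it. *)
Lemma lt_card_down x y :
  lt R x y -> #|[set w | le R w x]| < #|[set w | le R w y]|.
Proof.
move=> xy; apply/proper_card/properP; split.
  by apply/subsetP => w; rewrite !inE => /le_trans; apply; apply: ltW.
by exists y; rewrite !inE ?le_refl // lt_nle.
Qed.

(** Among the elements above [x] and at most [y], one with the smallest down-set has nothing
    strictly between it and [x]. *)
Lemma exists_upper_cover x y : lt R x y -> exists2 z, covers R x z & le R z y.
Proof.
move=> xy; have h : lt R x y && le R y y by rewrite xy le_refl.
case: (arg_minnP (P := fun z => lt R x z && le R z y)
  (fun z => #|[set w | le R w z]|) h) => z /andP[xz zy] zmin.
exists z => //; rewrite /covers xz /=; apply/forallP => w.
apply/negP => /andP[xw wz].
have := zmin w; rewrite xw (le_trans (ltW wz) zy) => /(_ isT).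
by rewrite leqNgt lt_card_down.
Qed.

Lemma exists_lower_cover x y : lt R x y -> exists2 z, le R x z & covers R z y.
Proof.
move=> xy; have h : le R x x && lt R x y by rewrite xy le_refl.
case: (arg_maxnP (P := fun z => le R x z && lt R z y)
  (fun z => #|[set w | le R w z]|) h) => z /andP[xz zy] zmax.
exists z => //; rewrite /covers zy /=; apply/forallP => w.
apply/negP => /andP[zw wy].
have := zmax w; rewrite wy (le_trans xz (ltW zw)) => /(_ isT).
by rewrite /= leqNgt lt_card_down.
Qed.

Lemma coatom_top a : is_coatom R a -> exists2 t, is_top R t & covers R a t.
Proof. by case/existsP=> t /andP[]; exists t. Qed.

Lemma atom_bot a : is_atom R a -> exists2 b, is_bot R b & covers R b a.
Proof. by case/existsP=> b /andP[]; exists b. Qed.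

Lemma coatom_not_top a : is_coatom R a -> ~~ is_top R a.
Proof.
case/coatom_top=> t tt /andP[/andP[_ at_] _].
by rewrite (top_eq _ tt).
Qed.

Lemma atom_not_bot a : is_atom R a -> ~~ is_bot R a.
Proof.
case/atom_bot=> b bb /andP[/andP[_ ba] _].
by rewrite (bot_eq _ bb) eq_sym.
Qed.

Lemma le_atom a x : is_atom R a -> ~~ is_bot R x -> le R x a -> x = a.
Proof.
case/atom_bot=> b bb /andP[_ /forallP/(_ x)] nb; rewrite (bot_eq _ bb) => xb xa.
apply/eqP; apply: contraNT nb => xna.
by rewrite /lt xa xna (forallP bb) eq_sym xb.
Qed.

Lemma coatom_le a x : is_coatom R a -> ~~ is_top R x -> le R a x -> x = a.
Proof.
case/coatom_top=> b bb /andP[_ /forallP/(_ x)] nb; rewrite (top_eq _ bb) => xb ax.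
apply/eqP; apply: contraNT nb => xna.
by rewrite /lt ax eq_sym xna (forallP bb) xb.
Qed.

Lemma exists_atom_below b x :
  is_bot R b -> ~~ is_bot R x -> exists2 a, is_atom R a & le R a x.
Proof.
move=> bb; rewrite (bot_eq _ bb) => xb.
have bx : lt R b x by rewrite /lt (forallP bb) eq_sym xb.
have [a ba ax] := exists_upper_cover bx.
by exists a => //; apply/existsP; exists b; rewrite bb.
Qed.

Lemma exists_coatom_above t x :
  is_top R t -> ~~ is_top R x -> exists2 a, is_coatom R a & le R x a.
Proof.
move=> tt; rewrite (top_eq _ tt) => xt.
have xlt : lt R x t by rewrite /lt (forallP tt) xt.
have [a xa cat] := exists_lower_cover xlt.
by exists a => //; apply/existsP; exists t; rewrite tt.
Qed.

Section Rank.
Variable r : {ffun 'I_n -> 'I_n}.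
Hypothesis rk : is_rank_fn R r.

Lemma rank_bot b : is_bot R b -> r b = 0 :> nat.
Proof. by case/andP: rk => /forallP/(_ b)/implyP h _ /h /eqP. Qed.

Lemma rank_cover x y : covers R x y -> r y = (r x).+1 :> nat.
Proof.
by case/andP: rk => _ /forallP/(_ x)/forallP/(_ y)/implyP h /h /eqP.
Qed.

(** Induction on the down-set of [y]: pass to a lower cover of [y] that is still above [x], where
    the rank drops by exactly one. *)
Lemma rank_lt x y : lt R x y -> r x < r y.
Proof.
move: {2}_.+1 (ltnSn #|[set w | le R w y]|) => N.
elim: N y => // N IH y leN xy.
have [z xz zy] := exists_lower_cover xy.
rewrite (rank_cover zy) ltnS.
case: (eqVneq x z) => [-> //|nxz].
apply/ltnW/IH; last by rewrite /lt xz.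
by rewrite -ltnS (leq_trans _ leN) // ltnS lt_card_down //; case/andP: zy.
Qed.

Lemma rank_le x y : le R x y -> r x <= r y.
Proof.
case: (eqVneq x y) => [-> //|nxy xy].
by apply/ltnW/rank_lt; rewrite /lt xy.
Qed.

Lemma rank_atom a : is_atom R a -> r a = 1 :> nat.
Proof. by case/atom_bot=> b bb /rank_cover ->; rewrite rank_bot. Qed.

End Rank.
End FinitePoset.

Lemma lattice_poset n (R : rel_on n) : is_lattice R -> is_poset R.
Proof. by case/and4P. Qed.

(** * Order embeddings and isomorphism classes *)

(** The sizes may differ, since two decompositions of one lattice are compared before their parts
    are known to have equal size. An embedding bounds the sizes, and at equal sizes it is an
    isomorphism. *)
Definition embeds m k (R : rel_on m) (S : rel_on k) :=
  exists2 f : 'I_m -> 'I_k, injective f & forall x y, S (f x, f y) = R (x, y).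

Lemma embeds_leq m k (R : rel_on m) (S : rel_on k) : embeds R S -> m <= k.
Proof. by case=> f /leq_card; rewrite !card_ord. Qed.

Lemma embeds_iso n (R S : rel_on n) : embeds R S -> iso R S.
Proof.
case=> f finj fR; apply/existsP; exists (perm finj).
by apply/forallP => x; apply/forallP => y; rewrite !permE fR.
Qed.

(* [s] and [s'] are the removed extremes: both tops ([u, v] = false, true) or
   both bottoms. *)
Lemma embeds_extend m k n (R : rel_on m) (S : rel_on k) (X : rel_on n)
    (f : 'I_m -> 'I_n) (g : 'I_k -> 'I_n) s s' u v :
  {in [pred a | a != s] &, injective f} ->
  (forall a b, a != s -> b != s -> le X (f a) (f b) = le R a b) ->
  (forall a b, a != s' -> b != s' -> le X (g a) (g b) = le S a b) ->
  (forall a, a != s -> exists2 b, b != s' & g b = f a) ->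
  le R s s -> le S s' s' ->
  (forall a, a != s -> le R s a = u /\ le R a s = v) ->
  (forall a, a != s' -> le S s' a = u /\ le S a s' = v) ->
  embeds R S.
Proof.
move=> finj fR gS fg Rs Ss Ruv Suv.
(* The embedding sends [s] to [s'] and agrees with [f] followed by the inverse of [g] elsewhere. *)
have ex a : exists b, if a == s then b = s' else b != s' /\ g b = f a.
  case: eqVneq => [_|/fg [b]]; first by exists s'.
  by exists b.
have [h hP] := fin_all_exists ex.
exists h => [a b|a b].
  have := hP b; have := hP a.
  case: (eqVneq a s) => [->|na]; case: (eqVneq b s) => [->|nb] //.
  - by move=> ha [/negPf hb _] e; rewrite -e ha eqxx in hb.
  - by move=> [/negPf ha _] hb e; rewrite e hb eqxx in ha.
  - by move=> [_ ea] [_ eb] e; apply: finj => //; rewrite -ea -eb e.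
have := hP b; have := hP a; rewrite -!/(le _ _ _).
case: (eqVneq a s) => [->|na]; case: (eqVneq b s) => [->|nb].
- by move=> ha _; rewrite ha Rs Ss.
- by move=> -> [/Suv [-> _] _]; case: (Ruv _ nb) => ->.
- by move=> [/Suv [_ hv] _] hb; rewrite hb hv; case: (Ruv _ na) => _ ->.
- by move=> [ha ea] [hb eb]; rewrite -fR // -gS // ea eb.
Qed.

Section Isomorphism.
Variable n : nat.
Implicit Types R S T : rel_on n.

Lemma isoP R S :
  reflect (exists p : {perm 'I_n}, forall x y, S (p x, p y) = R (x, y)) (iso R S).
Proof.
apply: (iffP existsP) => -[p h]; exists p.
  by move=> x y; apply/eqP; have /forallP/(_ x)/forallP/(_ y) := h.
by apply/forallP => x; apply/forallP => y; rewrite h.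
Qed.

Lemma iso_refl R : iso R R.
Proof. by apply/isoP; exists 1%g => x y; rewrite !perm1. Qed.

Lemma iso_sym R S : iso R S -> iso S R.
Proof.
by case/isoP=> p h; apply/isoP; exists p^-1%g => x y; rewrite -h !permKV.
Qed.

Lemma iso_trans R S T : iso R S -> iso S T -> iso R T.
Proof.
case/isoP=> p h /isoP [q h']; apply/isoP; exists (p * q)%g => x y.
by rewrite !permM h' h.
Qed.

Definition pairwise_noniso (T : {set rel_on n}) :=
  {in T &, forall R S, iso R S -> R = S}.

(** Taking isomorphism classes inside [S] is injective on [T]. Lower bounds on a number of classes
    thus reduce to exhibiting a set. *)
Lemma noniso_card_leq (T S : {set rel_on n}) :
  T \subset S -> pairwise_noniso T -> #|T| <= num_classes S.
Proof.
move=> /subsetP TS niT.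
rewrite -(card_in_imset (f := fun R => [set R' in S | iso R R']) (D := mem T)).
  apply: subset_leq_card; apply/subsetP => c /imsetP [R RT ->].
  by apply: imset_f; apply: TS.
move=> R R' RT R'T /setP/(_ R'); rewrite !inE TS // iso_refl => h.
exact: niT.
Qed.

(** A transversal of the partition of [S] into isomorphism classes. *)
Lemma exists_noniso (S : {set rel_on n}) :
  exists T : {set rel_on n},
    [/\ T \subset S, pairwise_noniso T & #|T| = num_classes S].
Proof.
have eqv : {in S & &, equivalence_rel (@iso n)}.
  move=> R R' R'' _ _ _; rewrite iso_refl; split=> // RR'.
  apply/idP/idP; [exact/iso_trans/iso_sym|exact: iso_trans].
have part := equivalence_partitionP eqv.
have tr := transversalP part.
exists (transversal (equivalence_partition (@iso n) S) S); split.
- exact: transversal_sub tr.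
- move=> R R' RT R'T RR'; apply: (pblock_inj tr) => //.
  have sub := subsetP (transversal_sub tr).
  apply/eqP; rewrite eq_pblock ?(cover_partition part) ?sub //.
    by rewrite pblock_equivalence_partition ?sub.
  by case/and3P: part.
- exact: card_transversal tr.
Qed.

End Isomorphism.

(** * The order of a vertical 2-sum *)

(** The content of [vsum2] for fixed labelling maps, with the summands regarded only as posets. *)
Record gluing k m n (L : rel_on k) (U : rel_on m) (X : rel_on n)
    (phi : 'I_k -> 'I_n) (psi : 'I_m -> 'I_n) : Prop := Gluing {
  glue_posL : is_poset L;
  glue_posU : is_poset U;
  glue_coatoms : #|coatoms L| = 2;
  glue_atoms : #|atoms U| = 2;
  glue_phi_inj : {in [pred a | ~~ is_top L a] &, injective phi};
  glue_psi_inj : {in [pred b | ~~ is_bot U b] &, injective psi};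
  glue_cover : forall x, (exists2 a, ~~ is_top L a & phi a = x) \/
                         (exists2 b, ~~ is_bot U b & psi b = x);
  glue_meet : forall a b, ~~ is_top L a -> ~~ is_bot U b -> phi a = psi b ->
                is_coatom L a /\ is_atom U b;
  glue_coatom_atom :
    forall a, is_coatom L a -> exists2 b, is_atom U b & phi a = psi b;
  glue_le : forall x y, le X x y = connect (gen_rel L U phi psi) x y }.

Lemma vsum2_gluing k m n (L : rel_on k) (U : rel_on m) (X : rel_on n) :
  vsum2 L U X -> exists phi psi, gluing L U X phi psi.
Proof.
by case=> /lattice_poset ? /lattice_poset ? ? ? [phi [psi [? ? ? [? ?] ?]]];
  exists phi, psi.
Qed.

(** The order of a sum is a reflexive transitive closure, so a property that respects the generating
    steps passes along the whole order. *)
Lemma backward_closed_connect (T : finType) (e : rel T) (A : T -> Prop) :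
  (forall x y, e x y -> A y -> A x) -> forall x y, connect e x y -> A y -> A x.
Proof.
move=> clA x y /connectP [p]; elim: p x => [|z p IH] x /=; first by move=> _ ->.
by case/andP=> xz pth yE Ay; apply: clA xz _; apply: IH Ay.
Qed.

Lemma forward_closed_connect (T : finType) (e : rel T) (A : T -> Prop) :
  (forall x y, e x y -> A x -> A y) -> forall x y, connect e x y -> A x -> A y.
Proof.
move=> clA x y /connectP [p]; elim: p x => [|z p IH] x /=; first by move=> _ ->.
by case/andP=> xz pth yE Ax; apply: IH pth yE _; apply: clA xz _.
Qed.

Section Gluing.
Variables (k m n : nat) (L : rel_on k) (U : rel_on m) (X : rel_on n).
Variables (phi : 'I_k -> 'I_n) (psi : 'I_m -> 'I_n).
Hypothesis gl : gluing L U X phi psi.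

Let posL := glue_posL gl.
Let posU := glue_posU gl.

Lemma gen_relP x y : gen_rel L U phi psi x y ->
  (exists a a', [/\ ~~ is_top L a, ~~ is_top L a', phi a = x, phi a' = y & le L a a'])
  \/ (exists b b', [/\ ~~ is_bot U b, ~~ is_bot U b', psi b = x, psi b' = y & le U b b']).
Proof.
case/orP=> /existsP [a /existsP [a' /and5P [? ? /eqP ? /eqP ? ?]]]; [left|right];
  by exists a, a'.
Qed.

(** Going down from the lower part never leaves it: a generating step of [U] that ends in the lower
    part ends at an atom of [U], and is therefore trivial once the bottom is removed. *)
Lemma le_phi_inv x a' : ~~ is_top L a' -> le X x (phi a') ->
  exists a, [/\ ~~ is_top L a, phi a = x & le L a a'].
Proof.
move=> ta'; rewrite (glue_le gl) => h.
pose A x := exists a, [/\ ~~ is_top L a, phi a = x & le L a a'].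
apply: (backward_closed_connect (A := A) _ h); last by exists a'; rewrite le_refl.
move=> {h}x' y /gen_relP [] [a1 [a2 [n1 n2 <- <- l12]]] [a3 [n3 e3 l3]].
  exists a1; split=> //; apply: (le_trans posL l12).
  by rewrite -(glue_phi_inj gl n3 n2 e3).
have [_ at2] := glue_meet gl n3 n2 e3.
by exists a3; split=> //; rewrite (le_atom posU at2 n1 l12).
Qed.

(** Dually, a generating step of [L] that starts in the upper part starts at a coatom and is
    trivial. *)
Lemma le_psi_inv x b' : ~~ is_bot U b' -> le X (psi b') x ->
  exists b, [/\ ~~ is_bot U b, psi b = x & le U b' b].
Proof.
move=> tb'; rewrite (glue_le gl) => h.
pose A x := exists b, [/\ ~~ is_bot U b, psi b = x & le U b' b].
apply: (forward_closed_connect (A := A) _ h); last by exists b'; rewrite le_refl.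
move=> {h}x' y /gen_relP [] [a1 [a2 [n1 n2 <- <- l12]]] [a3 [n3 e3 l3]].
  have [ca1 _] := glue_meet gl n1 n3 (esym e3).
  by exists a3; split=> //; rewrite (coatom_le posL ca1 n2 l12).
exists a2; split=> //; apply: (le_trans posU _ l12).
by rewrite -(glue_psi_inj gl n3 n1 e3).
Qed.

Lemma le_phi a a' : ~~ is_top L a -> ~~ is_top L a' ->
  le X (phi a) (phi a') = le L a a'.
Proof.
move=> na na'; apply/idP/idP => [/(le_phi_inv na') [b [nb e]]|laa'].
  by rewrite (glue_phi_inj gl nb na e).
rewrite (glue_le gl); apply: connect1; apply/orP; left.
by apply/existsP; exists a; apply/existsP; exists a'; rewrite na na' !eqxx.
Qed.

Lemma le_psi b b' : ~~ is_bot U b -> ~~ is_bot U b' ->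
  le X (psi b) (psi b') = le U b b'.
Proof.
move=> nb nb'; apply/idP/idP => [/(le_psi_inv nb) [a [na e]]|lbb'].
  by rewrite (glue_psi_inj gl na nb' e).
rewrite (glue_le gl); apply: connect1; apply/orP; right.
by apply/existsP; exists b; apply/existsP; exists b'; rewrite nb nb' !eqxx.
Qed.

Lemma phi_eq a a' : ~~ is_top L a -> ~~ is_top L a' ->
  (phi a == phi a') = (a == a').
Proof. by move=> na na'; apply: (inj_in_eq (glue_phi_inj gl)). Qed.

Lemma psi_eq a a' : ~~ is_bot U a -> ~~ is_bot U a' ->
  (psi a == psi a') = (a == a').
Proof. by move=> na na'; apply: (inj_in_eq (glue_psi_inj gl)). Qed.

Lemma lt_phi a a' : ~~ is_top L a -> ~~ is_top L a' ->
  lt X (phi a) (phi a') = lt L a a'.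
Proof. by move=> na na'; rewrite /lt le_phi // phi_eq. Qed.

Lemma lt_psi a a' : ~~ is_bot U a -> ~~ is_bot U a' ->
  lt X (psi a) (psi a') = lt U a a'.
Proof. by move=> na na'; rewrite /lt le_psi // psi_eq. Qed.

(** Whatever lies below [phi a'] comes from [L], so gluing puts nothing new in the interval; the
    removed top was never strictly below [a']. *)
Lemma covers_phi a a' : ~~ is_top L a -> ~~ is_top L a' ->
  covers X (phi a) (phi a') = covers L a a'.
Proof.
move=> na na'; rewrite /covers lt_phi //; congr (_ && _).
apply/forallP/forallP => h z; last first.
  apply/negP => /andP [h1 h2].
  have [b [nb eb _]] := le_phi_inv na' (ltW h2).
  by have := h b; rewrite -!lt_phi // eb h1 h2.
case tz : (is_top L z); last by have := h (phi z); rewrite !lt_phi // tz.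
apply/negP => /andP [_ h2]; case/andP: h2 => h2 /eqP; apply.
exact: (le_anti posL h2 (forallP tz _)).
Qed.

(** The images of the coatoms lie among the images of the atoms, and both sets have two elements, so
    they coincide. *)
Lemma atom_coatom b : is_atom U b -> exists2 a, is_coatom L a & phi a = psi b.
Proof.
move=> atb.
have nt a : a \in coatoms L -> ~~ is_top L a.
  by rewrite inE; apply: coatom_not_top.
have nb a : a \in atoms U -> ~~ is_bot U a.
  by rewrite inE; apply: atom_not_bot.
suff E : phi @: coatoms L = psi @: atoms U.
  have /imsetP [a] : psi b \in phi @: coatoms L by rewrite E imset_f ?inE.
  by rewrite inE => ca ->; exists a.
apply/eqP; rewrite eqEcard; apply/andP; split.
  apply/subsetP => x /imsetP [a]; rewrite inE => ca ->.
  have [b' ab' ->] := glue_coatom_atom gl ca.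
  by rewrite imset_f ?inE.
rewrite !card_in_imset ?(glue_atoms gl) ?(glue_coatoms gl) //.
  by move=> x y /nt hx /nt hy; apply: (glue_phi_inj gl).
by move=> x y /nb hx /nb hy; apply: (glue_psi_inj gl).
Qed.

Lemma glue_top : exists t, is_top L t.
Proof.
have : 0 < #|coatoms L| by rewrite (glue_coatoms gl).
by case/card_gt0P=> c; rewrite inE => /coatom_top [t]; exists t.
Qed.

Lemma glue_bot : exists b, is_bot U b.
Proof.
have : 0 < #|atoms U| by rewrite (glue_atoms gl).
by case/card_gt0P=> c; rewrite inE => /atom_bot [t]; exists t.
Qed.

Lemma phi_below_glue a : ~~ is_top L a -> exists2 c, is_coatom L c & le L a c.
Proof. by have [t tt] := glue_top; exact: (exists_coatom_above posL tt). Qed.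

Lemma psi_above_glue b : ~~ is_bot U b ->
  exists2 c, is_coatom L c & le X (phi c) (psi b).
Proof.
have [t bt] := glue_bot => nb.
have [d ad db] := exists_atom_below posU bt nb.
have [c cc e] := atom_coatom ad.
by exists c => //; rewrite e le_psi // (atom_not_bot posU ad).
Qed.

Lemma phi_bot b : is_bot L b -> is_bot X (phi b).
Proof.
move=> bb; apply/forallP => y.
have nb c : is_coatom L c -> le X (phi b) (phi c).
  move=> cc; have nc := coatom_not_top posL cc.
  (* A bottom that is also a top would make every element a top, including the coatom [c]. *)
  rewrite le_phi ?(forallP bb) //; apply: contra nc => tb.
  apply/forallP => z; exact: (le_trans posL (forallP tb _) (forallP bb _)).
case: (glue_cover gl y) => [[a na <-]|[d nd <-]].
  rewrite le_phi ?(forallP bb) //; apply: contra na => tb.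
  apply/forallP => z; exact: (le_trans posL (forallP tb _) (forallP bb _)).
have [c /nb bc cd] := psi_above_glue nd.
rewrite (glue_le gl); apply: (connect_trans (y := phi c));
  by rewrite -(glue_le gl).
Qed.

(** * Ranks in a vertical 2-sum *)

Section Rank.
Variables (rL : {ffun 'I_k -> 'I_k}) (r : {ffun 'I_n -> 'I_n}).
Hypotheses (rkL : is_rank_fn L rL) (posX : is_poset X) (rk : is_rank_fn X r).
Variables (b t : 'I_k).
Hypotheses (bb : is_bot L b) (tt : is_top L t).

(** Both rank functions vanish at the common bottom, and covers of the lower part stay covers in
    [X]; induct on the down-set of [a]. *)
Lemma rank_phi a : ~~ is_top L a -> r (phi a) = rL a :> nat.
Proof.
move: {2}_.+1 (ltnSn #|[set w | le L w a]|) => N.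
elim: N a => // N IH a leN na.
case: (eqVneq a b) => [->|nab].
  by rewrite (rank_bot rkL bb) (rank_bot rk (phi_bot bb)).
have ba : lt L b a by rewrite /lt (forallP bb) eq_sym.
have [z bz za] := exists_lower_cover posL ba.
have ltza : lt L z a by case/andP: za.
have nz : ~~ is_top L z.
  by apply/negP => /forallP/(_ a); rewrite (lt_nle posL ltza).
rewrite (rank_cover rkL za) -IH //; last first.
  by rewrite -ltnS (leq_trans _ leN) // ltnS lt_card_down.
by apply: (rank_cover rk); rewrite covers_phi.
Qed.

Lemma lt_top a : ~~ is_top L a -> lt L a t.
Proof. by rewrite (top_eq posL _ tt) /lt (forallP tt). Qed.

Lemma rank_coatom c : is_coatom L c -> (rL c).+1 = rL t.
Proof.
case/coatom_top=> t' tt' /(rank_cover rkL).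
by rewrite (top_unique posL tt' tt) => ->.
Qed.

Lemma rank_glue c : is_coatom L c -> (r (phi c)).+1 = rL t.
Proof. by move=> cc; rewrite rank_phi ?rank_coatom // coatom_not_top. Qed.

(** The glued pair fills its rank level: any other element lies strictly below a coatom of [L] or
    strictly above a glued element. The successor avoids a truncated subtraction. *)
Lemma rank_level z :
  (r z).+1 = rL t <-> exists2 c, is_coatom L c & phi c = z.
Proof.
split=> [rz|[c cc <-]]; last exact: rank_glue.
case: (glue_cover gl z) => [[a na ea]|[d nd ed]].
  have [c cc ac] := phi_below_glue na.
  exists c => //; rewrite -ea; congr phi; apply/esym/eqP.
  apply: contra_eqT rz => nac.
  rewrite -ea rank_phi // -(rank_coatom cc) eqSS neq_ltn.
  by rewrite (rank_lt posL rkL) // /lt ac.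
have [c cc cd] := psi_above_glue nd.
exists c => //; rewrite -ed; apply/eqP.
apply: contra_eqT rz => ncd.
rewrite -ed -(rank_glue cc) eqSS neq_ltn orbC.
by rewrite (rank_lt posX rk) // /lt cd.
Qed.

(** With [rank_upper], this recovers both parts of the sum from the ranks in [X] and the single
    number [rL t]; the glued pair belongs to both. *)
Lemma rank_lower z :
  r z < rL t <-> exists2 a, ~~ is_top L a & phi a = z.
Proof.
split=> [rz|[a na <-]]; last first.
  by rewrite rank_phi // (rank_lt posL rkL) // lt_top.
case: (glue_cover gl z) => // -[d nd ed].
have [c cc cd] := psi_above_glue nd.
exists c; first exact: coatom_not_top cc.
rewrite -ed; apply/eqP; apply: contraLR rz => ncd.
by rewrite -leqNgt -ed -(rank_glue cc) (rank_lt posX rk) // /lt cd.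
Qed.

Lemma rank_upper z :
  rL t <= (r z).+1 <-> exists2 d, ~~ is_bot U d & psi d = z.
Proof.
split=> [rz|[d nd <-]]; last first.
  have [c cc cd] := psi_above_glue nd.
  by rewrite -(rank_glue cc) ltnS (rank_le posX rk).
case: (glue_cover gl z) => // -[a na ea].
have [c cc ac] := phi_below_glue na.
have [d ad ecd] := glue_coatom_atom gl cc.
exists d; first exact: atom_not_bot ad.
rewrite -ecd -ea; congr phi; apply/esym/eqP; apply: contraLR rz => nac.
rewrite -ltnNge -ea rank_phi // -(rank_coatom cc) ltnS.
by rewrite (rank_lt posL rkL) // /lt ac.
Qed.

Lemma atoms_glued : 2 < rL t -> atoms X = phi @: atoms L.
Proof.
move=> rt; apply/setP => z; rewrite inE.
have bX := phi_bot bb.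
have nt a : rL a < rL t -> ~~ is_top L a.
  by apply: contraTN => ta; rewrite (top_unique posL ta tt) ltnn.
have nb : ~~ is_top L b by apply: nt; rewrite (rank_bot rkL bb) ltnW // ltnW.
apply/idP/imsetP => [az|[a]].
  have [|a na ea] := (rank_lower z).1.
    by rewrite (rank_atom rk az) ltnW.
  exists a => //; rewrite inE; apply/existsP; exists b; rewrite bb /=.
  case/atom_bot: az => b' bb'.
  by rewrite (bot_unique posX bb' bX) -ea covers_phi.
rewrite inE => aa ->; apply/existsP; exists (phi b); rewrite bX /=.
rewrite covers_phi //; last by apply: nt; rewrite (rank_atom rkL aa) ltnW.
by case/atom_bot: aa => b' bb'; rewrite (bot_unique posL bb' bb).
Qed.

Lemma card_atoms_glued : 2 < rL t -> #|atoms X| = #|atoms L|.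
Proof.
move=> rt; rewrite atoms_glued // card_in_imset // => x y.
have nt a : a \in atoms L -> ~~ is_top L a.
  rewrite inE => /(rank_atom rkL) ra; apply: contraTN rt => ta.
  by rewrite (top_unique posL tt ta) ra.
by move=> /nt hx /nt hy; apply: (glue_phi_inj gl).
Qed.

(** A glued element has rank one less than [rL t], and it is not the top of [X], since the other
    glued element is not below it. *)
Lemma rank_top_glued s : 2 < rL t -> is_top X s -> 2 < r s.
Proof.
move=> rt ts.
have /card_gt1P [x [y []]] : 1 < #|coatoms L| by rewrite (glue_coatoms gl).
rewrite !inE => cx cy nxy; apply: leq_trans rt _.
have ntx := coatom_not_top posL cx; have nty := coatom_not_top posL cy.
rewrite -(rank_glue cx) (rank_lt posX rk) // /lt (forallP ts) /=.
apply: contraNneq nxy => xs; apply/eqP/(coatom_le posL cy ntx).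
by rewrite -le_phi // xs (forallP ts).
Qed.

(** If the top of [X] covered a glued element, the top of [U] would cover an atom of [U] and so have
    rank two. *)
Lemma glued_not_coatom (rU : {ffun 'I_m -> 'I_m}) c :
  is_rank_fn U rU -> (forall t, is_top U t -> 2 < rU t) ->
  is_coatom L c -> ~~ is_coatom X (phi c).
Proof.
move=> rkU rkt cc; have [d ad ecd] := glue_coatom_atom gl cc.
have nd := atom_not_bot posU ad.
apply/negP => /coatom_top [s ts]; rewrite ecd => cov.
have [e [ne es lde]] := le_psi_inv nd (forallP ts _).
have [u bu] := glue_bot.
have te : is_top U e.
  apply/forallP => w; case bw : (is_bot U w); first exact: (forallP bw).
  by rewrite -le_psi ?bw // es (forallP ts).
move: (rkt e te); rewrite (rank_cover rkU (x := d)) ?(rank_atom rkU ad) //.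
case/andP: cov => ltds /forallP h; rewrite /covers -lt_psi // es ltds /=.
apply/forallP => w; apply/negP => /andP [dw we].
have nw : ~~ is_bot U w.
  apply: contraTN dw => /forallP/(_ d) wd; apply/negP => /(lt_nle posU).
  by rewrite wd.
by have := h (psi w); rewrite -es !lt_psi // dw we.
Qed.

(** The two coatoms of [L] give the neck: they fill a rank level, they are not atoms because [L] has
    rank at least three, and not coatoms because [U] does. *)
Lemma glued_neck (rU : {ffun 'I_m -> 'I_m}) :
  is_rank_fn U rU -> (forall t, is_top U t -> 2 < rU t) -> 2 < rL t ->
  [exists x, exists y, is_neck X r x y].
Proof.
move=> rkU rkt rt.
have /card_gt1P [x [y []]] : 1 < #|coatoms L| by rewrite (glue_coatoms gl).
rewrite !inE => cx cy nxy.
have ntx := coatom_not_top posL cx; have nty := coatom_not_top posL cy.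
have Exy : coatoms L = [set x; y].
  apply/esym/eqP; rewrite eqEcard cards2 nxy (glue_coatoms gl) andbT.
  by apply/subsetP => z; rewrite !inE => /orP [] /eqP ->.
have rx := rank_glue cx; have ry := rank_glue cy.
apply/existsP; exists (phi x); apply/existsP; exists (phi y).
have natom c : is_coatom L c -> ~~ is_atom X (phi c).
  move=> cc; apply: contraTN rt => /(rank_atom rk) h.
  by rewrite -(rank_glue cc) h.
rewrite /is_neck phi_eq // nxy -val_eqE /= -eqSS rx ry eqxx !natom //=.
rewrite !(glued_not_coatom rkU rkt) // !andbT.
apply/forallP => z; apply/implyP; rewrite -val_eqE /= -eqSS rx => /eqP/rank_level.
case=> c cc <-; have : c \in coatoms L by rewrite inE.
by rewrite Exy !inE => /orP [] /eqP ->; rewrite eqxx ?orbT.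
Qed.

End Rank.
End Gluing.

(** * Existence and isomorphism invariance of vertical 2-sums *)

Lemma exists_vsum2 k m n (L : rel_on k) (U : rel_on m) :
  is_lattice L -> is_lattice U -> #|coatoms L| = 2 -> #|atoms U| = 2 ->
  n + 4 = k + m -> exists X : rel_on n, vsum2 L U X.
Proof.
move=> latL latU cL aU nE.
have posL := lattice_poset latL; have posU := lattice_poset latU.
have /eqP/cards2P [c1 [c2 [nc EcL]]] := cL.
have /eqP/cards2P [b1 [b2 [nb EaU]]] := aU.
have cc1 : is_coatom L c1 by move/setP/(_ c1): EcL; rewrite !inE eqxx.
have cc2 : is_coatom L c2 by move/setP/(_ c2): EcL; rewrite !inE eqxx orbT.
have ab1 : is_atom U b1 by move/setP/(_ b1): EaU; rewrite !inE eqxx.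
have [t tt _] := coatom_top cc1; have [b bb _] := atom_bot ab1.
(* The carrier drops the atoms of [U] as well as the two extremes; the coatoms of [L] stand for the
   identified pair. This leaves [k - 1] plus [m - 3] elements. *)
pose A := [set s : 'I_k + 'I_m | match s with
  | inl a => ~~ is_top L a
  | inr d => ~~ is_bot U d && ~~ is_atom U d end].
have inlA a : (inl a \in A) = ~~ is_top L a by rewrite inE.
have inrA d : (inr d \in A) = ~~ is_bot U d && ~~ is_atom U d by rewrite inE.
have cbU : #|b |: atoms U| = 3.
  by rewrite cardsU1 aU inE (contraL (@atom_not_bot _ _ posU b) bb).
have m3 : 3 <= m by rewrite -[m]card_ord -cbU max_card.
have cA : #|A| = n.
  rewrite -sum1_card big_sumType /=.
  rewrite (eq_bigl (predC1 t)) => [|a]; last by rewrite inlA (top_eq posL _ tt).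
  rewrite sum1_card cardC1 card_ord.
  rewrite (eq_bigl (mem (~: (b |: atoms U)))) => [|d]; last first.
    by rewrite inrA /= !inE (bot_eq posU _ bb) negb_or.
  rewrite sum1_card cardsCs setCK cbU card_ord.
  by move: (ltn_ord t) m3 nE; clear; lia.
(* Now ['I_n] is the index type of [A], so [enum_rank_in] labels the carrier; [Ac1] serves as the
   proof that [A] is inhabited. *)
subst n.
have Ac1 : inl c1 \in A by rewrite inE coatom_not_top.
(* The gluing bijection sends [b1] to [c1] and [b2] to [c2]; off the atoms its value is
   arbitrary. *)
pose g d := if d == b1 then c1 else c2.
have cg d : is_coatom L (g d) by rewrite /g; case: ifP.
pose h d : 'I_k + 'I_m := if is_atom U d then inl (g d) else inr d.
have hA d : ~~ is_bot U d -> h d \in A.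
  rewrite /h; case: ifP => ad nd; last by rewrite inE nd ad.
  by rewrite inE coatom_not_top.
have rinj x y : enum_rank_in Ac1 x = enum_rank_in Ac1 y ->
    x \in A -> y \in A -> x = y.
  by move=> e Ax Ay; apply: enum_rank_in_inj e.
pose phi a := enum_rank_in Ac1 (inl a).
pose psi d := enum_rank_in Ac1 (h d).
exists [ffun p => connect (gen_rel L U phi psi) p.1 p.2]; split=> //.
have aE d : is_atom U d = (d == b1) || (d == b2).
  by move/setP/(_ d): EaU; rewrite !inE.
exists phi, psi; split.
- by move=> a a'; rewrite !inE => na na' /rinj; rewrite !inE => /(_ na na') [].
- move=> d d'; rewrite !inE => nd nd' /rinj => /(_ (hA _ nd) (hA _ nd')).
  rewrite /h; case: ifP => ad; case: ifP => ad' // [] //.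
  move: ad ad'; rewrite !aE /g => /orP [] /eqP -> /orP [] /eqP -> //;
    rewrite ?eqxx (eq_sym b2) (negPf nb) => /eqP; by rewrite ?(eq_sym c2) (negPf nc).
- move=> x; have := enum_valP x; rewrite inE.
  have := enum_valK_in Ac1 x; case: (enum_val x) => [a <- na|d <- /andP [nd ad]].
    by left; exists a.
  by right; exists d => //; rewrite /psi /h (negPf ad).
- split=> [a d na nd /rinj|a].
    move=> /(_ _ (hA _ nd)); rewrite inE na => /(_ isT); rewrite /h.
    by case: ifP => // ad [->]; split.
  move=> ca; have : a \in coatoms L by rewrite inE.
  rewrite EcL !inE => /orP [] /eqP ->; [exists b1 | exists b2];
    rewrite ?aE ?eqxx ?orbT // /psi /h aE ?eqxx ?orbT /g ?eqxx //.
  by rewrite eq_sym (negPf nb).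
- by move=> x y; rewrite /le ffunE.
Qed.

Lemma connect_homo (S T : finType) (f : S -> T) (e : rel S) (e' : rel T) :
  (forall x y, e x y -> e' (f x) (f y)) ->
  forall x y, connect e x y -> connect e' (f x) (f y).
Proof.
move=> ef x y /(forward_closed_connect (A := fun z => connect e' (f x) (f z))).
by apply=> // z w /ef/connect1 zw xz; apply: connect_trans zw.
Qed.

(** Relabelling: compose both labelling maps with the isomorphism, which carries generating steps to
    generating steps in both directions. *)
Lemma vsum2_iso k m n (L : rel_on k) (U : rel_on m) (X Y : rel_on n) :
  vsum2 L U X -> iso X Y -> vsum2 L U Y.
Proof.
move=> [latL latU cL aU [phi [psi [iphi ipsi cov [meet gl] leX]]]] /isoP [p pXY].
split=> //; exists (p \o phi), (p \o psi); split.
- by move=> a a' na na' /perm_inj; apply: iphi.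
- by move=> a a' na na' /perm_inj; apply: ipsi.
- move=> x; case: (cov (p^-1%g x)) => -[a na e]; [left|right];
    by exists a => //=; rewrite e permKV.
- split=> [a d na nd /perm_inj|a /gl [d ad e]]; first exact: meet.
  by exists d => //=; rewrite e.
move=> x y; rewrite -[x](permKV p) -[y](permKV p).
move: (p^-1%g x) (p^-1%g y) => {}x {}y.
rewrite /le pXY -/(le _ _ _) leX.
have gE z w : gen_rel L U phi psi z w = gen_rel L U (p \o phi) (p \o psi) (p z) (p w).
  by rewrite /gen_rel; congr (_ || _); apply: eq_existsb => a;
     apply: eq_existsb => a'; rewrite /= !(inj_eq perm_inj).
apply/idP/idP => [|h].
  by apply: connect_homo => z w; rewrite gE.
rewrite -[x](permK p) -[y](permK p).
by apply: connect_homo h => z w; rewrite gE !permKV.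
Qed.

(** * Comparing two decompositions of one lattice *)

Section Cancellation.
Variables (k m k' m' n : nat) (L : rel_on k) (U : rel_on m).
Variables (L' : rel_on k') (U' : rel_on m') (X : rel_on n).
Variables (phi : 'I_k -> 'I_n) (psi : 'I_m -> 'I_n).
Variables (phi' : 'I_k' -> 'I_n) (psi' : 'I_m' -> 'I_n).
Hypotheses (gl : gluing L U X phi psi) (gl' : gluing L' U' X phi' psi').
Variables (r : {ffun 'I_n -> 'I_n}) (rL : {ffun 'I_k -> 'I_k}).
Variables (rL' : {ffun 'I_k' -> 'I_k'}) (b t : 'I_k) (b' t' : 'I_k').
Hypotheses (posX : is_poset X) (rk : is_rank_fn X r).
Hypotheses (rkL : is_rank_fn L rL) (rkL' : is_rank_fn L' rL').
Hypotheses (bb : is_bot L b) (tt : is_top L t).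
Hypotheses (bb' : is_bot L' b') (tt' : is_top L' t').

(** If [L'] were taller than [L], the pair glued along [L] would lie inside the lower part [L'],
    below its coatoms and above its atoms, still filling a rank level: a neck of [L']. *)
Lemma rank_top_leq :
  2 < rL t -> ~~ [exists x, exists y, is_neck L' rL' x y] -> rL' t' <= rL t.
Proof.
move=> rt; apply: contraNT; rewrite -ltnNge => ltrt.
have level := rank_level gl rkL posX rk bb tt.
have posL := glue_posL gl; have posL' := glue_posL gl'.
have /eqP/cards2P [x [y [nxy Exy]]] := glue_coatoms gl.
have cx : is_coatom L x by move/setP/(_ x): Exy; rewrite !inE eqxx.
have cy : is_coatom L y by move/setP/(_ y): Exy; rewrite !inE eqxx orbT.
(* The rank of a glued element is small enough for it to come from [L']. *)
have back c : is_coatom L c ->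
    exists a, [/\ ~~ is_top L' a, phi' a = phi c & (rL' a).+1 = rL t].
  move=> cc; have rc : (r (phi c)).+1 = rL t by apply/level; exists c.
  have [|a na ea] := (rank_lower gl' rkL' posX rk bb' tt' (phi c)).1.
    by apply: leq_trans _ (ltnW ltrt); rewrite rc.
  by exists a; rewrite -(rank_phi gl' rkL' rk bb' na) ea.
have [u [nu eu ru]] := back _ cx; have [v [nv ev rv]] := back _ cy.
have natom a : (rL' a).+1 = rL t -> ~~ is_atom L' a.
  by move=> ra; apply: contraTN rt => /(rank_atom rkL') h; rewrite -ra h.
have ncoatom a : (rL' a).+1 = rL t -> ~~ is_coatom L' a.
  move=> ra; apply: contraTN ltrt => ca.
  by rewrite -ra (rank_coatom gl' rkL' tt' ca) ltnn.
apply/existsP; exists u; apply/existsP; exists v.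
rewrite /is_neck !natom ?ncoatom //.
rewrite -(phi_eq gl' nu nv) eu ev (phi_eq gl) ?(coatom_not_top posL) // nxy /=.
rewrite -val_eqE /= -eqSS ru rv eqxx !andbT /=.
apply/forallP => z; apply/implyP; rewrite -val_eqE /= -eqSS ru => /eqP rz.
have nz : ~~ is_top L' z.
  apply: contraTN ltrt => tz.
  by rewrite -(top_unique posL' tz tt') -rz ltnNge leqnSn.
have [] := (level (phi' z)).1; first by rewrite (rank_phi gl' rkL' rk bb' nz).
move=> c cc ec; have : c \in coatoms L by rewrite inE.
rewrite -(phi_eq gl' nz nu) -(phi_eq gl' nz nv) eu ev -ec Exy !inE.
by case/orP=> /eqP ->; rewrite eqxx ?orbT.
Qed.

Hypothesis eq_rank : rL t = rL' t' :> nat.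

(** Equal top ranks cut [X] at the same level, so both lower parts have the same image in [X]; only
    the removed tops remain to be matched. *)
Lemma lower_embeds : embeds L L'.
Proof.
have posL := glue_posL gl; have posL' := glue_posL gl'.
have low := rank_lower gl rkL posX rk bb tt.
have low' := rank_lower gl' rkL' posX rk bb' tt'.
apply: (embeds_extend (X := X) (f := phi) (g := phi') (s := t) (s' := t')
  (u := false) (v := true)).
- move=> a1 a2; rewrite !inE -!(top_eq posL _ tt); exact: glue_phi_inj gl _ _.
- by move=> a1 a2; rewrite -!(top_eq posL _ tt); apply: le_phi gl _ _.
- by move=> a1 a2; rewrite -!(top_eq posL' _ tt'); apply: le_phi gl' _ _.
- move=> a; rewrite -(top_eq posL _ tt) => na.
  have [|d nd ed] := (low' (phi a)).1; first by rewrite -eq_rank; apply/low; exists a.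
  by exists d => //; rewrite -(top_eq posL' _ tt').
- exact: le_refl.
- exact: le_refl.
- move=> a; rewrite -(top_eq posL _ tt) => na.
  have lat := lt_top gl tt na.
  by rewrite (lt_nle posL lat) (ltW lat).
- move=> a; rewrite -(top_eq posL' _ tt') => na.
  have lat := lt_top gl' tt' na.
  by rewrite (lt_nle posL' lat) (ltW lat).
Qed.

Lemma upper_embeds : embeds U U'.
Proof.
have posU := glue_posU gl; have posU' := glue_posU gl'.
have up := rank_upper gl rkL posX rk bb tt.
have up' := rank_upper gl' rkL' posX rk bb' tt'.
have [c bc] := glue_bot gl; have [c' bc'] := glue_bot gl'.
apply: (embeds_extend (X := X) (f := psi) (g := psi') (s := c) (s' := c')
  (u := true) (v := false)).
- move=> a1 a2; rewrite !inE -!(bot_eq posU _ bc); exact: glue_psi_inj gl _ _.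
- by move=> a1 a2; rewrite -!(bot_eq posU _ bc); apply: le_psi gl _ _.
- by move=> a1 a2; rewrite -!(bot_eq posU' _ bc'); apply: le_psi gl' _ _.
- move=> a; rewrite -(bot_eq posU _ bc) => na.
  have [|d nd ed] := (up' (psi a)).1; first by rewrite -eq_rank; apply/up; exists a.
  by exists d => //; rewrite -(bot_eq posU' _ bc').
- exact: le_refl.
- exact: le_refl.
- move=> a nac; have ltca : lt U c a by rewrite /lt (forallP bc) eq_sym.
  by rewrite (lt_nle posU ltca) (ltW ltca).
- move=> a nac; have ltca : lt U' c' a by rewrite /lt (forallP bc') eq_sym.
  by rewrite (lt_nle posU' ltca) (ltW ltca).
Qed.

End Cancellation.

(** * Sums whose lower summand is a piece *)

Lemma pieceP n (P : rel_on n) : is_piece P ->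
  [/\ is_lattice P, #|coatoms P| = 2, #|atoms P| = 2 &
   exists r b t, [/\ is_rank_fn P r, is_bot P b, is_top P t,
     ~~ [exists x, exists y, is_neck P r x y] & 2 < r t]].
Proof.
case/and5P=> lat _ /eqP aP /eqP cP /existsP [r /and3P [rk nn rt]].
split=> //.
have : 0 < #|coatoms P| by rewrite cP.
case/card_gt0P=> c; rewrite inE => /coatom_top [t tt _].
have : 0 < #|atoms P| by rewrite aP.
case/card_gt0P=> a; rewrite inE => /atom_bot [b bb _].
by exists r, b, t; split=> //; have /forallP/(_ t)/implyP := rt; apply.
Qed.

(** The shape required of an upper summand. Pieces have it, and gluing a piece underneath preserves
    it, so sums can be iterated. *)
Definition tall_two_atoms n (U : rel_on n) : bool :=
  (#|atoms U| == 2) &&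
  [exists r, is_rank_fn U r && [forall t, is_top U t ==> (2 < r t)]].

Lemma piece_tall n (P : rel_on n) : is_piece P -> tall_two_atoms P.
Proof.
case/and5P=> _ _ aP _ /existsP [r /and3P [rk _ rt]].
by rewrite /tall_two_atoms aP; apply/existsP; exists r; rewrite rk.
Qed.

(** Neither piece has a neck, so [rank_top_leq] applies in both directions and the two cuts of [X]
    are at the same rank. *)
Lemma vsum2_piece_cancel k m k' m' n (P : rel_on k) (U : rel_on m)
    (P' : rel_on k') (U' : rel_on m') (X : rel_on n) :
  is_piece P -> is_piece P' -> is_poset X -> graded X ->
  vsum2 P U X -> vsum2 P' U' X -> embeds P P' /\ embeds U U'.
Proof.
case/pieceP=> _ _ _ [rP [b [t [rkP bb tt nn rt]]]].
case/pieceP=> _ _ _ [rP' [b' [t' [rkP' bb' tt' nn' rt']]]].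
move=> posX /existsP [r rk] /vsum2_gluing [phi [psi gl]].
case/vsum2_gluing=> phi' [psi' gl'].
have e : rP t = rP' t' :> nat.
  apply/eqP; rewrite eqn_leq.
  rewrite (rank_top_leq gl' gl posX rk rkP' rkP bb' tt' bb tt) //.
  by rewrite (rank_top_leq gl gl' posX rk rkP rkP' bb tt bb' tt').
split; first exact: (lower_embeds gl gl' posX rk rkP rkP' bb tt bb' tt' e).
exact: (upper_embeds gl gl' posX rk rkP rkP' bb tt bb' tt' e).
Qed.

(** The glued pair is a neck for every rank function of [X], in particular for the one that would
    witness a piece. *)
Lemma vsum2_not_piece k m n (P : rel_on k) (U : rel_on m) (X : rel_on n) :
  is_piece P -> tall_two_atoms U -> vsum2 P U X -> ~~ is_piece X.
Proof.
case/pieceP=> _ _ _ [rP [b [t [rkP bb tt _ rt]]]].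
case/andP=> _ /existsP [rU /andP [rkU /forallP rtU]].
case/vsum2_gluing=> phi [psi gl].
apply/negP => /pieceP [/lattice_poset posX _ _ [r [_ [_ [rk _ _ /negP nn _]]]]].
apply: nn; apply: (glued_neck gl rkP posX rk bb tt rkU _ rt) => s.
exact/implyP.
Qed.

Lemma vsum2_tall k m n (P : rel_on k) (U : rel_on m) (X : rel_on n) :
  is_piece P -> is_poset X -> graded X -> vsum2 P U X -> tall_two_atoms X.
Proof.
case/pieceP=> _ _ aP [rP [b [t [rkP bb tt _ rt]]]] posX /existsP [r rk].
case/vsum2_gluing=> phi [psi gl]; apply/andP; split.
  by rewrite (card_atoms_glued gl rkP posX rk bb tt rt) aP.
apply/existsP; exists r; rewrite rk; apply/forallP => s; apply/implyP.
exact: (rank_top_glued gl rkP posX rk bb tt rt).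
Qed.

(** * Counting sums by the size of their lowest piece *)

Section Counting.
Variable F : lat_family.
Hypothesis HF : forall n (R : rel_on n), R \in F n ->
  [&& is_lattice R, graded R & vert_indec R].
Hypothesis Hsum : forall m k n (L : rel_on m) (U : rel_on k) (X : rel_on n),
  L \in F m -> U \in F k -> vsum2 L U X -> X \in F n.

Lemma family_poset n (R : rel_on n) : R \in F n -> is_poset R.
Proof. by case/HF/and3P=> /lattice_poset. Qed.

Lemma family_graded n (R : rel_on n) : R \in F n -> graded R.
Proof. by case/HF/and3P. Qed.

(** Such a set certifies a lower bound; the recurrence is realised by building these sets
    explicitly. *)
Definition tall_noniso n (T : {set rel_on n}) :=
  [/\ T \subset F n, {in T, forall R, tall_two_atoms R} & pairwise_noniso T].

Lemma exists_noniso_pieces n :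
  exists T : {set rel_on n},
    [/\ tall_noniso T, {in T, forall R, is_piece R} & #|T| = f_pc F n].
Proof.
have [T [/subsetP TS niT cT]] := exists_noniso [set R in F n | is_piece R].
have TP R : R \in T -> R \in F n /\ is_piece R by move/TS; rewrite inE => /andP.
exists T; split=> // [|R /TP []] //.
split=> //; first by apply/subsetP => R /TP [].
by move=> R /TP [_ /piece_tall].
Qed.

(** Induction on the cutoff [c], adjoining at each stage the sums whose lower piece has exactly [k]
    elements. The starting set [T0] and the cutoff are left free to cover both ranges of the
    recurrence. *)
Lemma exists_noniso_sums n (g : nat -> nat) (T0 : {set rel_on n}) :
  (forall m, 0 < m < n -> exists2 T : {set rel_on m}, tall_noniso T & #|T| = g m) ->
  tall_noniso T0 -> {in T0, forall R, is_piece R} ->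
  forall c, c <= n -> exists2 T : {set rel_on n}, tall_noniso T &
    #|T| = #|T0| + \sum_(6 <= k < c) f_pc F k * g (n - k + 4).
Proof.
move=> IH tT0 pT0 c cn.
(* The invariant also records that the lower pieces used so far have fewer than [c] elements, which
   separates old members from new ones. *)
suff [T [tT cT _]] : exists T : {set rel_on n}, [/\ tall_noniso T,
    #|T| = #|T0| + \sum_(6 <= k < c) f_pc F k * g (n - k + 4) &
    {in T, forall X, is_piece X \/ exists k m (P : rel_on k) (U : rel_on m),
      [/\ k < c, is_piece P & vsum2 P U X]}] by exists T.
elim: c cn => [_|k IHk kn].
  by exists T0; split=> // [|X /pT0]; [rewrite big_geq ?addn0|left].
have [T [[/subsetP TF tallT niT] cT pieceT]] := IHk (ltnW kn).
have [k6|k6] := ltnP k 6.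
  exists T; split=> [||X /pieceT [|[k' [m [P [U [? ? ?]]]]]]].
  - by split=> //; apply/subsetP.
  - by rewrite cT !big_geq // ltnW.
  - by left.
  - by right; exists k', m, P, U; split=> //; rewrite ltnS ltnW.
(* The size of the upper summand, as a sum has [k + m - 4] elements; [6 <= k] makes it smaller than
   [n]. *)
pose m := n - k + 4.
have [Q [[/subsetP QF _ niQ] pQ cQ]] := exists_noniso_pieces k.
have [|V [/subsetP VF tallV niV] cV] := IH m; first by rewrite /m; lia.
pose D := setX Q V.
have ex (pu : rel_on k * rel_on m) :
    exists X : rel_on n, pu \in D -> vsum2 pu.1 pu.2 X.
  (* Outside [D] the chosen relation is a dummy. *)
  case: (boolP (pu \in D)) => [|_]; last by exists [ffun=> true].
  rewrite !inE => /andP [q1 v2].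
  have [latP caP _ _] := pieceP (pQ _ q1).
  have /and3P [latU _ _] := HF (VF _ v2).
  have /andP [/eqP aU _] := tallV _ v2.
  have [|X sX] := exists_vsum2 (n := n) latP latU caP aU; last by exists X.
  by rewrite /m; lia.
have [s sP] := fin_all_exists ex.
have DP pu : pu \in D -> [/\ pu.1 \in F k, is_piece pu.1, pu.2 \in F m,
    tall_two_atoms pu.2 & pu.1 \in Q /\ pu.2 \in V].
  by rewrite !inE => /andP [q v]; split; auto.
have sF pu : pu \in D -> s pu \in F n.
  by move=> d; have [f1 _ f2 _ _] := DP _ d; apply: Hsum f1 f2 (sP _ d).
(* Here the sizes agree, so cancellation gives isomorphic summands, which are equal because [Q] and
   [V] hold no two distinct isomorphic members. *)
have siso pu pv : pu \in D -> pv \in D -> iso (s pu) (s pv) -> pu = pv.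
  move=> du dv /(vsum2_iso (sP _ du)) sv.
  have [fu pu1 _ _ [qu vu]] := DP _ du; have [fv pv1 _ _ [qv vv]] := DP _ dv.
  have posX := family_poset (sF _ dv); have grX := family_graded (sF _ dv).
  have [/embeds_iso e1 /embeds_iso e2] :=
    vsum2_piece_cancel pu1 pv1 posX grX sv (sP _ dv).
  by rewrite [pu]surjective_pairing [pv]surjective_pairing (niQ _ _ qu qv e1)
             (niV _ _ vu vv e2).
(* A new sum is no piece, and cancellation against an older sum would embed a [k]-element piece into
   a smaller one. *)
have Tiso X pu : X \in T -> pu \in D -> iso (s pu) X -> False.
  move=> XT du /(vsum2_iso (sP _ du)) sX; have [_ pu1 _ tu _] := DP _ du.
  case: (pieceT _ XT) => [|[k' [m' [P [U [ltk pP sPX]]]]]].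
    by apply/negP/(vsum2_not_piece pu1 tu sX).
  have posX := family_poset (TF _ XT); have grX := family_graded (TF _ XT).
  have [/embeds_leq] := vsum2_piece_cancel pu1 pP posX grX sX sPX.
  by rewrite leqNgt ltk.
exists (T :|: s @: D); split.
- split.
  + apply/subsetP => X; rewrite inE => /orP [/TF //|/imsetP [pu du ->]].
    exact: sF.
  + move=> X; rewrite inE => /orP [/tallT //|/imsetP [pu du ->]].
    have [_ p _ _ _] := DP _ du.
    apply: (vsum2_tall p _ _ (sP _ du)); first exact: family_poset (sF _ du).
    exact: family_graded (sF _ du).
  + move=> X Y; rewrite !inE => /orP [XT|/imsetP [pu du ->]].
      case/orP=> [YT|/imsetP [pu du ->]]; first exact: niT.
      by move=> /iso_sym/(Tiso _ _ XT du).
    case/orP=> [YT|/imsetP [pv dv ->]]; first by move/(Tiso _ _ YT du).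
    by move/siso=> ->.
- rewrite big_nat_recr //= addnA -cT cardsU.
  have -> : T :&: s @: D = set0.
    apply/setP => X; rewrite !inE; apply/negP => /andP [XT /imsetP [pu du eX]].
    by apply: (Tiso _ _ XT du); rewrite eX iso_refl.
  rewrite cards0 subn0; congr (_ + _).
  rewrite card_in_imset ?cardsX ?cQ ?cV // => pu pv du dv e.
  by apply: siso => //; rewrite e iso_refl.
move=> X; rewrite inE => /orP [/pieceT|/imsetP [pu du ->]].
  case=> [|[k' [m' [P [U [ltk pP sPX]]]]]]; first by left.
  by right; exists k', m', P, U; split=> //; rewrite ltnS ltnW.
right; exists k, m, pu.1, pu.2; split=> //; last exact: sP.
by have [] := DP _ du.
Qed.

End Counting.

Theorem theorem3p7 (F : lat_family)
  (HF : forall n (R : rel_on n), R \in F n ->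
          [&& is_lattice R, graded R & vert_indec R])
  (Hiso : forall n (R R' : rel_on n), iso R R' -> R \in F n -> R' \in F n)
  (Hsum : forall m k n (L : rel_on m) (U : rel_on k) (X : rel_on n),
          L \in F m -> U \in F k -> vsum2 L U X -> X \in F n)
  (N : nat) (HN : 6 <= N) (g : nat -> nat)
  (g_small : forall n, 1 <= n <= 6 -> g n = f_pc F n)
  (g_mid : forall n, 7 <= n <= N ->
           g n = f_pc F n + \sum_(6 <= k < n) f_pc F k * g (n - k + 4))
  (g_large : forall n, N.+1 <= n ->
           g n = \sum_(6 <= k < N.+1) f_pc F k * g (n - k + 4)) :
  forall n, 1 <= n -> g n <= f_vi F n.
Proof.
move=> n n1.
(* The induction needs tall members with two atoms, so that they can serve again as upper
   summands. *)
suff [T [TF _ niT] <-] : exists2 T : {set rel_on n}, tall_noniso F T & #|T| = g n.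
  exact: noniso_card_leq.
elim/ltn_ind: n n1 => n IHn n1.
have IH m : 0 < m < n -> exists2 T : {set rel_on m}, tall_noniso F T & #|T| = g m.
  by case/andP=> m1 mn; apply: IHn.
have [T [tT pT cT]] := exists_noniso_pieces F n.
have [n6|n6] := leqP n 6; first by exists T; rewrite // g_small ?n1.
have [nN|nN] := leqP n N.
  by rewrite g_mid ?n6 // -cT; apply: exists_noniso_sums.
(* Beyond [N] the recurrence has no term for pieces of size [n] and stops at lower pieces of size
   [N]: start from the empty set with cutoff [N.+1]. *)
have [||T' tT' cT'] := exists_noniso_sums HF Hsum (T0 := set0) IH _ _ nN.
- by split=> [|R|R S]; rewrite ?sub0set ?inE.
- by move=> R; rewrite inE.
by exists T' => //; rewrite cT' cards0 g_large.
Qed.
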